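(* Let $m\geq 3$ and $n\geq 1$ be integers and let $f:S_m^n\to S_m$ satisfy Independence of Rankings (IR): for every voter $i\in[n]$, every alternative $j\in[m]$, every $x^{-i}\in S_m^{n-1}$ and all $x_i,y_i\in S_m$ with $x_i^{-1}(j)=y_i^{-1}(j)$, one has $f(x^{-i},x_i)^{-1}(j)=f(x^{-i},y_i)^{-1}(j)$. Then either $f$ is a constant function, or there exist a voter $i\in[n]$ and a permutation $y\in S_m$ such that for every profile $x=(x_1,\dots,x_n)\in S_m^n$ one has $f(x)=x_i\circ y$, i.e. $f(x)(r)=x_i(y(r))$ for all ranks $r\in[m]$.
   Context: $S_m$ is the symmetric group on $[m]=\{1,\dots,m\}$. An element $x\in S_m$ is a ranking of $m$ alternatives, with the convention $x(\text{rank})=\text{name}$; thus $x^{-1}(j)$ is the rank given to alternative $j$. A profile is $x=(x_1,\dots,x_n)\in S_m^n$ ($x_i$ is voter $i$'s ranking), and $(x^{-i},y_i)$ denotes the profile obtained from $x$ by replacing $x_i$ with $y_i$. Here $\circ$ is ordinary composition, $(u\circ v)(r)=u(v(r))$; the paper writes the dictatorial form as ''$y\circ x_i$'', composing permutations left to right, which is the map $r\mapsto x_i(y(r))$ stated here. *)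

(* Defs.v *)
From mathcomp Require Import all_boot all_fingroup.

Set Implicit Arguments.
Unset Strict Implicit.
Unset Printing Implicit Defensive.

(* Rankings are permutations of 'I_m with the convention x rank = name, so that
   x^-1 j is the rank of alternative j; ranks and alternatives are numbered
   from 0. *)
Definition profile (n m : nat) := {ffun 'I_n -> 'S_m}.

(* The profile (x^{-i}, y). *)
Definition replace_vote (n m : nat) (x : profile n m) (i : 'I_n) (y : 'S_m) :
    profile n m :=
  [ffun k => if k == i then y else x k].

Definition independence_of_rankings (n m : nat) (f : profile n m -> 'S_m) : Prop :=
  forall (i : 'I_n) (j : 'I_m) (x : profile n m) (y : 'S_m),
    ((x i)^-1)%g j = (y^-1)%g j ->
    ((f x)^-1)%g j = ((f (replace_vote x i y))^-1)%g j.

(* Main.v *)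
Require Import Defs.
From mathcomp Require Import all_boot all_fingroup.

(** By IR, the rank [f] gives to [j] is a function [outcome_rank f j] of the
    vector [u] of ranks the voters give to [j].  If one voter [i] exchanges [j]
    and [k], all other alternatives keep their rank in the outcome, so either
    [j] does not move, or [j] and [k] exchange their ranks.  Hence if moving [j]
    from [a] to [b] in the ranking of [i] changes the outcome rank of [j] when
    the other voters rank [j] according to [p], then every [k <> j] gets the
    same outcome rank as [j] did, whenever [i] ranks it [a] (or [b]) and the
    others rank it according to any [q] differing from [p] everywhere.  As
    [m >= 3], three such steps lead from any alternative and rank vector to any
    other, so the outcome rank of an alternative depends only on its rank in
    the ballot of [i]: this voter is the dictator. *)

Set Implicit Arguments.
Unset Strict Implicit.
Unset Printing Implicit Defensive.

Definition update (n : nat) (T : Type) (x : {ffun 'I_n -> T}) (i : 'I_n) (a : T) :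
    {ffun 'I_n -> T} :=
  [ffun k => if k == i then a else x k].

(** Coordinates pass from [x] to [y] one at a time in index order, so coordinate [i] still has the
    value [x i] when its turn comes. *)
Lemma eq_from_updates (n : nat) (T R : Type) (F : {ffun 'I_n -> T} -> R)
    (x y : {ffun 'I_n -> T}) :
  (forall (z : {ffun _ -> _}) i, z i = x i -> F z = F (update z i (y i))) -> F x = F y.
Proof.
move=> Fupd.
pose z k : {ffun 'I_n -> T} := [ffun i : 'I_n => if i < k then y i else x i].
have Fz k : k <= n -> F x = F (z k).
  elim: k => [_|k IHk ltkn].
    by congr F; apply/ffunP => i; rewrite ffunE.
  rewrite IHk 1?ltnW // (Fupd _ (Ordinal ltkn)) ?ffunE ?ltnn //.
  congr F; apply/ffunP => i; rewrite !ffunE ltnS.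
  have [-> | ] := eqVneq i (Ordinal ltkn); first by rewrite leqnn.
  by rewrite -val_eqE /= [i <= k]leq_eqVlt => /negPf ->.
by rewrite (Fz n) //; congr F; apply/ffunP => i; rewrite ffunE ltn_ord.
Qed.

Lemma exists_avoiding2 (m : nat) (a b : 'I_m) :
  2 < m -> exists c, (c != a) && (c != b).
Proof.
move=> m_gt2; have: 0 < #|~: [set a; b]|.
  rewrite cardsCs setCK card_ord subn_gt0 (leq_ltn_trans _ m_gt2) //.
  by rewrite cards2; case: (a != b).
by case/card_gt0P => c; rewrite !inE negb_or; exists c.
Qed.

Lemma ffun_avoiding2 (n m : nat) (p q : {ffun 'I_n -> 'I_m}) :
  2 < m -> exists r : {ffun 'I_n -> 'I_m},
    (forall i, r i != p i) /\ (forall i, r i != q i).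
Proof.
move=> m_gt2; pose c i := xchoose (exists_avoiding2 (p i) (q i) m_gt2).
by exists (finfun c); split=> i; rewrite ffunE;
  case/andP: (xchooseP (exists_avoiding2 (p i) (q i) m_gt2)).
Qed.

Lemma exists_perm2 (T : finType) (a b j k : T) :
  a != b -> j != k -> exists s : {perm T}, s a = j /\ s b = k.
Proof.
move=> neq_ab neq_jk; exists (tperm a j * tperm (tperm a j b) k)%g.
rewrite !permM !tpermL; split=> //; apply: tpermD; last by rewrite eq_sym.
by rewrite -[X in _ != X](tpermL a j) (inj_eq perm_inj) eq_sym.
Qed.

(** The preimage of [s j] under [t] is not [j], and by injectivity of [s] it is no alternative where
    [s] and [t] agree; only [k] is left. *)
Lemma perm_agree_off2 (T : finType) (s t : {perm T}) (j k : T) :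
  (forall l, l != j -> l != k -> s l = t l) -> s j != t j -> t k = s j.
Proof.
move=> eq_st neq_j; pose l := (t^-1)%g (s j).
have tl : t l = s j by rewrite permKV.
have [lj | neq_lj] := eqVneq l j; first by rewrite -tl lj eqxx in neq_j.
have [<- // | neq_lk] := eqVneq l k.
by move: tl; rewrite -eq_st // => /perm_inj lj; rewrite lj eqxx in neq_lj.
Qed.

(* The transposition of [j] and [u i] is just one ballot ranking [j] at [u i]. *)
Definition outcome_rank (n m : nat) (f : profile n m -> 'S_m) (j : 'I_m)
    (u : {ffun 'I_n -> 'I_m}) : 'I_m :=
  ((f [ffun i => tperm j (u i)])^-1)%g j.

Lemma outcome_rankE (n m : nat) (f : profile n m -> 'S_m) (x : profile n m)
    (j : 'I_m) (u : {ffun 'I_n -> 'I_m}) :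
  independence_of_rankings f -> (forall i, x i (u i) = j) ->
  ((f x)^-1)%g j = outcome_rank f j u.
Proof.
move=> IRf xu; apply: (eq_from_updates (F := fun x => ((f x)^-1)%g j)) => z i zi.
apply: IRf; rewrite zi ffunE tpermV tpermL.
by apply: (@perm_inj _ (x i)); rewrite permKV xu.
Qed.

Lemma outcome_rank_step (n m : nat) (f : profile n m -> 'S_m) (i : 'I_n)
    (j k a b : 'I_m) (p q : {ffun 'I_n -> 'I_m}) :
  independence_of_rankings f -> j != k -> (forall l, p l != q l) ->
  outcome_rank f j (update p i a) != outcome_rank f j (update p i b) ->
  outcome_rank f k (update q i a) = outcome_rank f j (update p i a).
Proof.
move=> IRf neq_jk neq_pq neq_g.
have neq_ab : a != b by apply: contraNneq neq_g => ->.
pose u := update p i a; pose v := update q i b.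
have neq_uv l : u l != v l by rewrite !ffunE; case: ifP.
have ballotP l : exists s : 'S_m, (s (u l) == j) && (s (v l) == k).
  have [s [su sv]] := exists_perm2 (neq_uv l) neq_jk.
  by exists s; rewrite su sv !eqxx.
(* Such ballots exist because [u] and [v] differ everywhere: at [i] since [a != b], elsewhere by
   [neq_pq]. *)
have [x xuv] : exists x : profile n m, forall l, x l (u l) = j /\ x l (v l) = k.
  exists [ffun l => xchoose (ballotP l)] => l.
  by have /andP[/eqP su /eqP sv] := xchooseP (ballotP l); rewrite [_ l]ffunE.
have xu l : x l (u l) = j by case: (xuv l).
have xv l : x l (v l) = k by case: (xuv l).
(* In the ballot of [i], [j] moves from [a] to [b] and [k] from [b] to [a]. *)
pose x' := replace_vote x i (x i * tperm j k)%g.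
have ui : u i = a by rewrite ffunE eqxx.
have vi : v i = b by rewrite ffunE eqxx.
have x'j l : x' l (update p i b l) = j.
  have [->|/negPf li] := eqVneq l i; last first.
    by rewrite -[RHS](xu l) !ffunE li.
  by rewrite !ffunE eqxx permM -vi xv tpermR.
have x'k l : x' l (update q i a l) = k.
  have [->|/negPf li] := eqVneq l i; last first.
    by rewrite -[RHS](xv l) !ffunE li.
  by rewrite !ffunE eqxx permM -ui xu tpermL.
rewrite -(outcome_rankE IRf xu) -(outcome_rankE IRf x'k).
apply: perm_agree_off2; last first.
  by rewrite (outcome_rankE IRf xu) (outcome_rankE IRf x'j).
move=> l neq_lj neq_lk; apply: IRf.
by rewrite invMg permM tpermV tpermD // eq_sym.
Qed.

Lemma outcome_rank_local (n m : nat) (f : profile n m -> 'S_m) (i : 'I_n)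
    (j k a b : 'I_m) (p q : {ffun 'I_n -> 'I_m}) :
  2 < m -> independence_of_rankings f ->
  outcome_rank f j (update p i a) != outcome_rank f j (update p i b) ->
  outcome_rank f k (update q i a) = outcome_rank f j (update p i a) /\
  outcome_rank f k (update q i b) = outcome_rank f j (update p i b).
Proof.
move=> m_gt2 IRf neq_g.
have step (j1 k1 : 'I_m) (p1 q1 : {ffun 'I_n -> 'I_m}) : k1 != j1 -> (forall l, q1 l != p1 l) ->
    outcome_rank f j1 (update p1 i a) = outcome_rank f j (update p i a) /\
    outcome_rank f j1 (update p1 i b) = outcome_rank f j (update p i b) ->
    outcome_rank f k1 (update q1 i a) = outcome_rank f j (update p i a) /\
    outcome_rank f k1 (update q1 i b) = outcome_rank f j (update p i b).
  rewrite eq_sym => neq_jk neq_qp [eqa eqb].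
  have neq_pq l : p1 l != q1 l by rewrite eq_sym.
  rewrite -eqa -eqb in neq_g *; split.
    exact: (outcome_rank_step IRf neq_jk neq_pq neq_g).
  by rewrite eq_sym in neq_g; exact: (outcome_rank_step IRf neq_jk neq_pq neq_g).
(* The chains [j, j1, j2, k] and [p, p1, p2, q] differ at each link, even if [k = j] or [q] meets
   [p]. *)
have [j1 /andP[neq_j1 _]] := exists_avoiding2 j j m_gt2.
have [j2 /andP[neq_j2 neq_j2k]] := exists_avoiding2 j1 k m_gt2.
have [p1 [neq_p1 _]] := ffun_avoiding2 p p m_gt2.
have [p2 [neq_p2 neq_p2q]] := ffun_avoiding2 p1 q m_gt2.
apply: (step j2 k p2 q) => [|l|]; rewrite 1?eq_sym //.
apply: (step j1 j2 p1 p2) => //.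
exact: (step j j1 p p1).
Qed.

Theorem theorem3p3 (m n : nat) (hm : 3 <= m) (hn : 1 <= n)
    (f : profile n m -> 'S_m) (hf : independence_of_rankings f) :
  (exists c : 'S_m, forall x : profile n m, f x = c) \/
  (exists (i : 'I_n) (y : 'S_m),
     forall (x : profile n m) (r : 'I_m), f x r = x i (y r)).
Proof.
pose pivotal i j p a b :=
  outcome_rank f j (update p i a) != outcome_rank f j (update p i b).
have rankE x j : ((f x)^-1)%g j = outcome_rank f j [ffun i => ((x i)^-1)%g j].
  by apply: outcome_rankE => // i; rewrite ffunE permKV.
case: (boolP [exists i, exists j, exists p, exists a, exists b, pivotal i j p a b]).
  case/existsP=> i /existsP[j /existsP[p /existsP[a /existsP[b piv_ab]]]].
  (* If all ballots are the identity, rank and name coincide, so this outcome lists which rank in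
     the ballot of [i] is sent to each outcome rank. *)
  right; exists i, (f [ffun=> 1%g]).
  have local k q c :
      outcome_rank f k (update q i c) = outcome_rank f j (update p i c).
    (* The values at [a] and [b] differ, so the value at [c] differs from one of them and [c]
       belongs to a pivotal pair. *)
    have [eq_ac | neq_ac] :=
      eqVneq (outcome_rank f j (update p i a)) (outcome_rank f j (update p i c)).
      have piv_bc : pivotal i j p b c by rewrite /pivotal -eq_ac eq_sym.
      by have [] := outcome_rank_local k q hm hf piv_bc.
    by have [] := outcome_rank_local k q hm hf neq_ac.
  have dictated x k :
      ((f x)^-1)%g k = outcome_rank f j (update p i (((x i)^-1)%g k)).
    rewrite rankE -(local k [ffun l => ((x l)^-1)%g k]); congr outcome_rank.
    by apply/ffunP => l; rewrite !ffunE; case: eqP => [->|].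
  move=> x r; apply: (@perm_inj _ (f x)^-1%g); rewrite permK dictated permK.
  set c := f _ r; have := dictated [ffun=> 1%g] c.
  by rewrite /c permK ffunE invg1 perm1.
move/existsPn => no_pivot; left; exists (f [ffun=> 1%g]) => x.
apply: invg_inj; apply/permP => j; rewrite !rankE.
(* With no pivotal voter, changing one entry of the rank vector of [j] never changes its outcome
   rank. *)
apply: eq_from_updates => z i _; apply/eqP.
have := no_pivot i; move/existsPn/(_ j)/existsPn/(_ z)/existsPn/(_ (z i)).
move/existsPn/(_ ([ffun l => (([ffun=> 1%g] l : 'S_m)^-1)%g j] i)).
rewrite negbK; congr (_ == _); congr outcome_rank.
by apply/ffunP => l; rewrite ffunE; case: eqP => [->|].
Qed.
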